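(* Let $\mathbb{K}$ be a field. Up to isomorphism there exist exactly fifty-eight square free monomial Cremona transformations of $\mathbb{P}^5$. That is, the total number, over all degrees $d$ with $1\le d\le 5$, of isomorphism classes of square free monomial Cremona sets $F=\{f_1,\dots,f_6\}\subset\mathbb{K}[x_1,\dots,x_6]$ of degree $d$ is $58$.
   Context: Let $F=\{f_1,\dots,f_n\}$ be a set of $n$ monomials of the same degree $d$ in $\mathbb{K}[x_1,\dots,x_n]$. A monomial is square free if no $x_i^2$ divides it; $F$ is square free if all its elements are. $F$ is called a Cremona set (of degree $d$) if the extension $\mathbb{K}[f_1,\dots,f_n]\subset \mathbb{K}[\underline{x}_d]$ becomes an equality on the level of fields of fractions, where $\mathbb{K}[\underline{x}_d]$ is the Veronese algebra generated by all monomials of degree $d$ in $x_1,\dots,x_n$. Equivalently, the rational map $\mathbb{P}^{n-1}\dashrightarrow\mathbb{P}^{n-1}$, $\underline{x}\mapsto (f_1(\underline{x}):\dots:f_n(\underline{x}))$ is birational. Standing assumption: $F$ satisfies the canonical restrictions, i.e. for each $j=1,\dots,n$ there is a $k$ with $x_j\mid f_k$ and there is a $k$ with $x_j\nmid f_k$. The symmetric group $S_n$ acts on monomials by permuting variables, hence on sets of monomials. Two Cremona sets $F,F'$ are isomorphic if $F'=\sigma(F)$ (as unordered sets) for some $\sigma\in S_n$. *)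

(* Defs.v *)
From mathcomp Require Import all_boot all_order all_fingroup all_algebra.
From mathcomp Require Import finmap.
From mathcomp Require Import mpoly.

Set Implicit Arguments.
Unset Strict Implicit.
Unset Printing Implicit Defensive.

Import GRing.Theory.

Local Open Scope ring_scope.

(* A monomial x^m is represented by its exponent vector m : 'X_{1..n}, and a
   set of monomials by a finite set of such vectors. The order (_ <= _)%MM is
   the pointwise order on exponents, i.e. divisibility of monomials. *)

Definition square_free_mnm (n : nat) (m : 'X_{1..n}) : Prop :=
  forall i : 'I_n, ~~ (U_(i) *+ 2 <= m)%MM.

Definition square_free (n : nat) (F : {fset 'X_{1..n}}) : Prop :=
  forall m, m \in F -> square_free_mnm m.

Definition canonical_restrictions (n : nat) (F : {fset 'X_{1..n}}) : Prop :=
  forall j : 'I_n,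
    (exists2 m, m \in F & (U_(j) <= m)%MM) /\
    (exists2 m, m \in F & ~~ (U_(j) <= m)%MM).

Section Subalgebra.
Variables (K : fieldType) (A : algType K).

Inductive subalgebra (S : A -> Prop) : A -> Prop :=
| subalgebra_gen x of S x : subalgebra S x
| subalgebra_scalar c : subalgebra S c%:A
| subalgebra_add x y of subalgebra S x & subalgebra S y : subalgebra S (x + y)
| subalgebra_mul x y of subalgebra S x & subalgebra S y : subalgebra S (x * y).

End Subalgebra.

Section Cremona.
Variables (K : fieldType) (n : nat).

(* The field of fractions of a subring A of K[x_1, .., x_n], realised inside
   K(x_1, .., x_n). *)
Definition fraction_field (A : {mpoly K[n]} -> Prop)
    (z : {fraction {mpoly K[n]}}) : Prop :=
  exists a b : {mpoly K[n]},
    [/\ A a, A b, b != 0 & z = FracField.tofrac a / FracField.tofrac b].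

Definition monomial_algebra (F : {fset 'X_{1..n}}) : {mpoly K[n]} -> Prop :=
  subalgebra (fun p => exists2 m, m \in F & p = 'X_[m]).

Definition veronese_algebra (d : nat) : {mpoly K[n]} -> Prop :=
  subalgebra (fun p => exists2 m : 'X_{1..n}, mdeg m = d & p = 'X_[m]).

Definition cremona_set (d : nat) (F : {fset 'X_{1..n}}) : Prop :=
  [/\ #|` F| = n,
      forall m, m \in F -> mdeg m = d,
      canonical_restrictions F
    & forall z, fraction_field (monomial_algebra F) z <->
                fraction_field (veronese_algebra d) z].

End Cremona.

(* The monomial obtained by substituting x_(s i) for x_i. *)
Definition mnm_act (n : nat) (s : 'S_n) (m : 'X_{1..n}) : 'X_{1..n} :=
  [multinom m ((s^-1)%g i) | i < n].

Definition isomorphic (n : nat) (F F' : {fset 'X_{1..n}}) : Prop :=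
  exists s : 'S_n, F' = [fset mnm_act s m | m in F]%fset.

(* For an equivalence relation E: the elements satisfying P fall into exactly
   N classes, witnessed by an irredundant system of representatives. *)
Definition number_of_classes (T : Type) (P : T -> Prop) (E : T -> T -> Prop)
    (N : nat) : Prop :=
  exists r : 'I_N -> T,
    [/\ forall i, P (r i),
        forall i j, E (r i) (r j) -> i = j
      & forall x, P x -> exists i, E (r i) x].

(* Main.v *)
(* The sets of n monomials of degree d whose fraction field is that of the Veronese
   algebra are those whose exponent vectors span the lattice of integer vectors of
   degree divisible by d. This lattice has the basis d e_0, e_j - e_0, in which the
   coordinates of a vector v of degree d are (1, v_1, .., v_(n-1)); so the condition
   is that replacing the first column of the exponent matrix by ones gives a matrix of
   determinant 1 or -1.

   Square-free sets are enumerated up to isomorphism by adding one monomial at a time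
   and sorting the variables by an isomorphism-invariant key, with no attempt to break
   ties. The key of the variable i is the i-th diagonal entry of A^4, where
   A = M^T M and M is the exponent matrix. It happens that the enumeration ends with
   exactly 58 unimodular sets, and that these have distinct multisets of keys; hence no
   two of them are isomorphic. *)
From HB Require Import structures.
From Stdlib Require Import BinNat.
Require Import Defs.
From mathcomp Require Import all_boot all_order all_fingroup all_algebra.
From mathcomp Require Import finmap.
From mathcomp Require Import mpoly.

Set Implicit Arguments.
Unset Strict Implicit.
Unset Printing Implicit Defensive.

Import GRing.Theory.

Local Open Scope ring_scope.

(** * Fraction fields and lattices *)

(** The coefficients are natural numbers because these vectors are exponents of actual products of
    the [t i]; integer combinations enter as differences, in [spans_degree]. *)
Definition monomial_span (k n : nat) (t : 'I_k -> 'X_{1..n}) (v : 'X_{1..n}) : Prop :=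
  exists c : 'I_k -> nat, v = (\sum_i t i *+ c i)%MM.

Lemma monomial_span0 k n (t : 'I_k -> 'X_{1..n}) : monomial_span t 0%MM.
Proof. by exists (fun=> 0%N); rewrite big1. Qed.

Lemma monomial_spanD k n (t : 'I_k -> 'X_{1..n}) u v :
  monomial_span t u -> monomial_span t v -> monomial_span t (u + v)%MM.
Proof.
move=> [c ->] [c' ->]; exists (fun i => (c i + c' i)%N).
rewrite -big_split; apply: eq_bigr => i _.
by apply/mnmP => j; rewrite mnmDE !mulmnE mulnDr.
Qed.

Lemma monomial_span_gen k n (t : 'I_k -> 'X_{1..n}) i : monomial_span t (t i).
Proof.
exists (fun j => (i == j) : nat); rewrite (bigD1 i) //= eqxx mulm1n big1 ?addm0 //.
by move=> j; rewrite eq_sym => /negPf->.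
Qed.

(* Each monomial of degree d is a quotient of products of the monomials [t i]. *)
Definition spans_degree (k n : nat) (t : 'I_k -> 'X_{1..n}) (d : nat) : Prop :=
  forall m : 'X_{1..n}, mdeg m = d ->
    exists2 a, monomial_span t a & monomial_span t (m + a)%MM.

Section FractionFields.
Variables (K : fieldType) (n : nat).
Implicit Types (F : {fset 'X_{1..n}}) (p q : {mpoly K[n]}).
Local Notation "p %:F" := (FracField.tofrac p).

Lemma subalgebra1 (A : algType K) (S : A -> Prop) : subalgebra S 1.
Proof. by rewrite -[1]scale1r; apply: subalgebra_scalar. Qed.

Lemma subalgebra_mono (A : algType K) (S T : A -> Prop) x :
  (forall y, S y -> T y) -> subalgebra S x -> subalgebra T x.
Proof.
move=> sST; elim=> [y /sST|c|y z _ ? _ ?|y z _ ? _ ?].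
- exact: subalgebra_gen.
- exact: subalgebra_scalar.
- exact: subalgebra_add.
- exact: subalgebra_mul.
Qed.

Lemma monomial_algebra_msupp k (t : 'I_k -> 'X_{1..n}) F p v :
  F =i codom t -> monomial_algebra F p -> v \in msupp p -> monomial_span t v.
Proof.
move=> Ft Fp; elim: Fp v => {p} [p [m Fm ->]|c|p q _ IHp _ IHq|p q _ IHp _ IHq] v.
- rewrite msuppX inE => /eqP->; move: Fm; rewrite Ft => /codomP[i ->].
  exact: monomial_span_gen.
- move/msuppZ_le; rewrite msupp1 inE => /eqP->; exact: monomial_span0.
- by move/msuppD_le; rewrite mem_cat => /orP[/IHp|/IHq].
- by move/msuppM_le => /allpairsP[[u w] /= [/IHp tu /IHq tw ->]]; apply: monomial_spanD.
Qed.

Lemma monomial_algebra_span k (t : 'I_k -> 'X_{1..n}) F v :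
  F =i codom t -> monomial_span t v -> monomial_algebra F ('X_[v] : {mpoly K[n]}).
Proof.
move=> Ft [c ->]; apply: (big_ind (fun v => monomial_algebra F ('X_[v] : {mpoly K[n]}))).
- by rewrite mpolyX0; apply: subalgebra1.
- by move=> u w Fu Fw; rewrite mpolyXD; apply: subalgebra_mul.
move=> i _; elim: (c i) => [|j IHj]; first by rewrite mulm0n mpolyX0; apply: subalgebra1.
rewrite mulmS mpolyXD; apply: subalgebra_mul => //; apply: subalgebra_gen.
by exists (t i) => //; rewrite Ft codom_f.
Qed.

(** Fractions over an algebra are closed under sums and products, so only the generators of the
    other algebra have to be written as fractions. *)
Lemma fraction_field_subalgebra (S : {mpoly K[n]} -> Prop) a (T : {mpoly K[n]} -> Prop) :
  (forall p, T p -> fraction_field (subalgebra S) p%:F) ->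
  subalgebra T a -> fraction_field (subalgebra S) a%:F.
Proof.
move=> TS; elim=> {a} [p /TS//|c|p q _ IHp _ IHq|p q _ IHp _ IHq].
- exists c%:A, 1; split; rewrite ?oner_neq0 ?tofrac1 ?divr1 //.
    exact: subalgebra_scalar.
  exact: subalgebra1.
- move: IHp IHq => [a [b [Sa Sb b0 pE]]] [a' [b' [Sa' Sb' b'0 qE]]].
  exists (a * b' + a' * b), (b * b'); split; rewrite ?mulf_neq0 //.
  + by apply: subalgebra_add; apply: subalgebra_mul.
  + exact: subalgebra_mul.
  + by rewrite tofracD pE qE !tofracM tofracD !tofracM addf_div ?tofrac_eq0.
- move: IHp IHq => [a [b [Sa Sb b0 pE]]] [a' [b' [Sa' Sb' b'0 qE]]].
  exists (a * a'), (b * b'); split; rewrite ?mulf_neq0 //.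
  + exact: subalgebra_mul.
  + exact: subalgebra_mul.
  + by rewrite tofracM pE qE !tofracM mulf_div.
Qed.

(** An equation between polynomials whose supports lie in the span can be compared monomial by
    monomial, which turns a quotient of polynomials into a quotient of monomials. Conversely,
    quotients of monomials for the Veronese generators suffice, by closure under sums, products and
    division. *)
Lemma fraction_field_eqP k (t : 'I_k -> 'X_{1..n}) F d :
  F =i codom t -> (forall m, m \in F -> mdeg m = d) ->
  (forall z, fraction_field (@monomial_algebra K n F) z <->
             fraction_field (@veronese_algebra K n d) z)
  <-> spans_degree t d.
Proof.
move=> Ft Fd; split=> [eqFV m dm|tspan z].
  have: fraction_field (@veronese_algebra K n d) ('X_[m])%:F.
    exists 'X_[m], 1; split; rewrite ?oner_neq0 ?tofrac1 ?divr1 //.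
      by apply: subalgebra_gen; exists m.
    exact: subalgebra1.
  move/eqFV=> [a [b [Fa Fb b0 mab]]].
  have {mab} mab : 'X_[m] * b = a.
    by apply/eqP; rewrite -tofrac_eq tofracM mab divfK ?tofrac_eq0.
  case: (msupp b =P [::]) => [/eqP|]; first by rewrite msupp_eq0 (negPf b0).
  case Eb: (msupp b) => [//|v s] _.
  have vb : v \in msupp b by rewrite Eb mem_head.
  (* Any monomial [v] of the nonzero denominator will do: multiplication by ['X_[m]] shifts the
     support, so [m + v] occurs in [a]. *)
  exists v; first exact: (monomial_algebra_msupp Ft Fb).
  apply: (monomial_algebra_msupp Ft Fa).
  by rewrite -mab ['X_[m] * b]mulrC mcoeff_msupp mcoeffMX -mcoeff_msupp.
split.
  move=> [a [b [Fa Fb b0 ->]]]; exists a, b; split=> //; [move: Fa | move: Fb];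
    by apply: subalgebra_mono => p [m /Fd md ->]; exists m.
have VF a : veronese_algebra d a -> fraction_field (@monomial_algebra K n F) a%:F.
  apply: fraction_field_subalgebra => p [m /tspan[v tv tmv] ->].
  exists 'X_[m + v], 'X_[v]; split; try exact: (monomial_algebra_span Ft).
    by rewrite -msupp_eq0 msuppX.
  by rewrite mpolyXD tofracM mulfK // tofrac_eq0 -msupp_eq0 msuppX.
move=> [a [b [/VF [a1 [b1 [Fa1 Fb1 b10 ->]]] /VF [a2 [b2 [Fa2 Fb2 b20 eb]]] b0 ->]]].
have a20 : a2 != 0.
  apply: contra b0 => /eqP a20; rewrite -tofrac_eq0 eb a20 tofrac0 mul0r //.
exists (a1 * b2), (b1 * a2); split; rewrite ?mulf_neq0 //; try exact: subalgebra_mul.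
by rewrite eb !tofracM invf_div mulf_div.
Qed.

End FractionFields.

(* The coordinates of the [t i] in the basis d e_0, e_j - e_0 of the lattice of integer
   vectors of degree divisible by d, when every [t i] has degree d. *)
Definition reduced_log_matrix (n : nat) (t : 'I_n.+1 -> 'X_{1..n.+1}) : 'M[int]_n.+1 :=
  \matrix_(i, j) (if j == 0 then 1%N else t i j)%:Z.

(** Solving for d e_0 and (d-1) e_0 + e_j yields a left inverse of the matrix row by row.
    Conversely, an inverse expresses every monomial of degree d by integer coefficients, whose
    positive and negative parts give numerator and denominator. *)
Lemma spans_degreeP n (t : 'I_n.+1 -> 'X_{1..n.+1}) d :
  (0 < d)%N -> (forall i, mdeg (t i) = d) ->
  spans_degree t d <-> reduced_log_matrix t \in unitmx.
Proof.
move=> d0 td; set C := reduced_log_matrix t; split.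
  move=> tspan.
  have solve m : mdeg m = d ->
      exists w : 'rV[int]_n.+1, w *m C = \row_j (if j == 0 then 1%N else m j)%:Z.
    move=> md; have [a [c ac] [c' mac]] := tspan m md.
    have deg_span e : mdeg (\sum_i t i *+ e i)%MM = (d * \sum_i e i)%N.
      rewrite mdeg_sum big_distrr; apply: eq_bigr => i _; by rewrite mdegMn td.
    exists (\row_i ((c' i)%:Z - (c i)%:Z)); apply/rowP => j; rewrite !mxE.
    under eq_bigr => i _ do rewrite !mxE mulrBl -!PoszM.
    rewrite sumrB -!(big_morph Posz PoszD (erefl _)).
    apply/eqP; rewrite subr_eq -PoszD; apply/eqP; congr Posz.
    case: eqP => [j0|_].
      (* The first coordinate counts factors: comparing degrees and cancelling [d > 0], the
         numerator has exactly one factor more than the denominator. *)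
      apply/eqP; rewrite -(eqn_pmul2l d0) mulnDr muln1.
      under eq_bigr => i _ do rewrite muln1.
      under [in X in _ == (_ + d * X)%N]eq_bigr => i _ do rewrite muln1.
      by rewrite -!deg_span -mac -ac mdegD md.
    have := congr1 (fun v : 'X_{1..n.+1} => v j) mac.
    rewrite ac mnmDE !mnm_sumE => mE.
    rewrite [LHS](eq_bigr (fun i => (t i *+ c' i)%MM j)) => [|i _]; last first.
      by rewrite mulmnE mulnC.
    rewrite -mE; congr addn; apply: eq_bigr => i _; by rewrite mulmnE mulnC.
  (* The monomial d e_0 has coordinates (1, 0, .., 0). *)
  have [w0 w0C] := solve (U_(ord0) *+ d)%MM ltac:(by rewrite mdegMn mdeg1 mul1n).
  have wP (j : 'I_n.+1) : exists w : 'rV[int]_n.+1, w *m C == row j 1%:M.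
    have w0E : w0 *m C = row ord0 1%:M.
      rewrite w0C; apply/rowP => k; rewrite !mxE mulmnE mnm1E eq_sym.
      by case: eqP => //= _; rewrite mul0n.
    have [->|j0] := eqVneq j ord0; first by exists w0; apply/eqP.
    (* Its coordinates are those of d e_0 plus the j-th unit row, so subtracting [w0] isolates that
       row. *)
    have [|w wC] := solve (U_(ord0) *+ d.-1 + U_(j))%MM.
      by rewrite mdegD mdegMn !mdeg1 mul1n addn1 prednK.
    exists (w - w0); rewrite mulmxBl wC w0E; apply/eqP/rowP => k.
    rewrite !mxE mnmDE mulmnE !mnm1E eq_sym; case: eqP => [<-|_].
      by rewrite (negPf j0).
    by rewrite mul0n add0n subr0; case: eqP.
  pose W : 'M[int]_n.+1 := \matrix_i xchoose (wP i).
  have WC : W *m C = 1%:M.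
    by apply/row_matrixP => i; rewrite row_mul rowK; apply/eqP/(xchooseP (wP i)).
  by have [] := mulmx1_unit WC.
move=> uC m md.
pose w := (\row_j (if j == 0 then 1%N else m j)%:Z) *m invmx C.
have wC : w *m C = \row_j (if j == 0 then 1%N else m j)%:Z by rewrite mulmxKV.
have sum_w : \sum_i w 0 i = 1.
  move/rowP/(_ ord0): wC; rewrite !mxE eqxx => wC0; rewrite -[RHS]/(Posz 1) -wC0.
  by apply: eq_bigr => i _; rewrite !mxE eqxx mulr1.
have wt_neq0 j : j != 0 -> \sum_i w 0 i * (t i j)%:Z = (m j)%:Z.
  move=> j0; move/rowP/(_ j): wC; rewrite !mxE (negPf j0) => <-.
  by apply: eq_bigr => i _; rewrite !mxE (negPf j0).
have sum_wt : \sum_j \sum_i w 0 i * (t i j)%:Z = \sum_j (m j)%:Z.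
  rewrite exchange_big /=.
  rewrite -!(big_morph Posz PoszD (erefl _)) -mdegE md -[RHS]mul1r -sum_w mulr_suml.
  apply: eq_bigr => i _; rewrite -mulr_sumr -(big_morph Posz PoszD (erefl _)).
  by rewrite -mdegE td.
have wt j : \sum_i w 0 i * (t i j)%:Z = (m j)%:Z.
  (* The exponents of variable 0 are absent from the matrix; they are recovered from the total
     degree, as all other exponents agree. *)
  have [->|/wt_neq0//] := eqVneq j 0.
  move: sum_wt; rewrite (bigD1 0) //= [RHS](bigD1 0) //=.
  by rewrite [X in _ + X = _](eq_bigr _ wt_neq0) => /addIr.
(* [pos x] and [pos (- x)] are the positive and negative parts of [x]. *)
pose pos (x : int) := if x is Posz k then k else 0%N.
have posB x : (pos x)%:Z - (pos (- x))%:Z = x.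
  by case: x => [[|k]|k] //=; rewrite ?subr0 ?sub0r.
exists (\sum_i t i *+ pos (- w 0 i)%R)%MM; first by exists (fun i => pos (- w 0 i)).
exists (fun i => pos (w 0 i)); apply/mnmP => j.
apply/eqP; rewrite -eqz_nat mnmDE PoszD -wt !mnm_sumE !(big_morph Posz PoszD (erefl _)).
rewrite -subr_eq0 -big_split -sumrB big1 //= => i _.
rewrite !mulmnE !PoszM -{1}(posB (w 0 i)) mulrBl.
by rewrite ![(t i j)%:Z * _]mulrC subrK subrr.
Qed.

(** * Square-free monomials as bit vectors *)

(* Laplace expansion along the first column, whose alternating sum is computed as
   t_0 - (t_1 - (t_2 - ..)). *)
Fixpoint bit_det k (M : seq bitseq) : int :=
  if k is k'.+1 then
    foldr (fun i acc => (if head false (nth [::] M i)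
                         then bit_det k' [seq behead r | r <- take i M ++ drop i.+1 M]
                         else 0) - acc)
      0 (iota 0 k)
  else 1.

Lemma foldr_alternating (f : nat -> int) m k :
  foldr (fun i acc => f i - acc) 0 (iota m k) = \sum_(i < k) (-1) ^+ i * f (m + i)%N.
Proof.
elim: k m => [|k IHk] m /=; first by rewrite big_ord0.
rewrite IHk big_ord_recl addn0 mul1r -sumrN; congr (_ + _); apply: eq_bigr => i _.
by rewrite exprS mulN1r mulNr lift0 addSnnS.
Qed.

Lemma bit_detE k M :
  size M = k -> bit_det k M = \det (\matrix_(i < k, j < k) (nth false (nth [::] M i) j : nat)%:Z).
Proof.
elim: k M => [|k IHk] M sM; first by rewrite det_mx00.
rewrite [LHS]foldr_alternating (expand_det_col _ ord0); apply: eq_bigr => i _.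
rewrite mxE add0n nth0 /cofactor addn0; case: head; last by rewrite mulr0 mul0r.
rewrite mul1r -/bit_det; congr (_ * _); rewrite IHk; last first.
  by rewrite size_map size_cat size_take size_drop sM ltn_ord subSS subnKC // -ltnS.
congr (\det _); apply/matrixP => a b; rewrite !mxE.
rewrite (nth_map [::]) ?nth_behead; last first.
  by rewrite size_cat size_take size_drop sM ltn_ord subSS subnKC // -ltnS.
(* [lift i] skips the deleted row: indices below [i] stay, the others move up by one. *)
rewrite nth_cat size_take sM ltn_ord [nat_of_ord (lift i a)]/= /bump.
have [ai|ia] := ltnP a i; first by rewrite nth_take // leqNgt ai.
by rewrite nth_drop addSn subnKC // ia.
Qed.

Fixpoint cube n : seq bitseq :=
  if n is n'.+1 then map (cons true) (cube n') ++ map (cons false) (cube n')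
  else [:: [::]].

(** The fixed order matters: [normalize] filters this list, so that equal sets become equal lists
    and [undup] can merge them. *)
Definition slice n d : seq bitseq := [seq m <- cube n | count id m == d].

Definition relabel (p : seq nat) (m : bitseq) : bitseq := [seq nth false m i | i <- p].

Lemma mem_cube n m : (m \in cube n) = (size m == n).
Proof.
have consI b : injective (cons b : bitseq -> bitseq) by move=> ? ? [].
have consF b c (s : seq bitseq) m' : b != c -> (b :: m' \in map (cons c) s) = false.
  by move=> bc; apply/mapP => -[x _ [bE]]; rewrite bE eqxx in bc.
elim: n m => [|n IHn] [|b m] //=; rewrite mem_cat.
  by apply/orP => -[] /mapP[].
by case: b; rewrite mem_map // consF // ?orbF IHn.
Qed.

Lemma mem_slice n d m : (m \in slice n d) = (count id m == d) && (size m == n).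
Proof. by rewrite mem_filter mem_cube. Qed.

Lemma slice_cube n d : {subset slice n d <= cube n}.
Proof. exact: mem_subseq (filter_subseq _ _). Qed.

Lemma cube_uniq n : uniq (cube n).
Proof.
have consI b : injective (cons b : bitseq -> bitseq) by move=> ? ? [].
elim: n => [//|n IHn] /=; rewrite cat_uniq !map_inj_uniq // IHn andbT /=.
by apply/hasPn => _ /mapP[m _ ->]; apply/mapP => -[].
Qed.

Lemma relabel_slice n d p m :
  perm_eq p (iota 0 n) -> m \in slice n d -> relabel p m \in slice n d.
Proof.
move=> pP; rewrite !mem_slice => /andP[/eqP<- /eqP sm].
rewrite size_map (perm_size pP) size_iota eqxx andbT count_map (seq.permP pP).
by rewrite -[X in _ == count _ X](mkseq_nth false) sm count_map.
Qed.

Lemma nth_relabel n p m i : perm_eq p (iota 0 n) -> (i < n)%N ->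
  nth false (relabel p m) i = nth false m (nth 0%N p i).
Proof. by move=> pP ltin; rewrite (nth_map 0%N) // (perm_size pP) size_iota. Qed.

Section Multinomials.
Variable n : nat.
Implicit Types (s : 'S_n) (m : bitseq) (X Y : seq bitseq) (F : {fset 'X_{1..n}}).

Definition mnm_of_bits m : 'X_{1..n} := [multinom (nth false m i : nat) | i < n].
Definition bits_of_mnm (v : 'X_{1..n}) : bitseq := [seq v i != 0%N | i <- enum 'I_n].
Definition mnm_set X : {fset 'X_{1..n}} := [fset mnm_of_bits m | m in X]%fset.
(** The inverse follows the convention of [mnm_act], so that [relabel] by this sequence is the
    action of [s] on bit vectors. *)
Definition seq_of_perm s : seq nat := [seq val ((s^-1)%g i) | i <- enum 'I_n].

Lemma square_free_mnmP (v : 'X_{1..n}) : square_free_mnm v <-> forall i, (v i <= 1)%N.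
Proof.
split=> sfv i; last first.
  apply/negP => /mnm_lepP/(_ i); rewrite mulmnE mnm1E eqxx mul1n => vi.
  by have := leq_trans vi (sfv i).
rewrite leqNgt; apply: contra (sfv i) => vi; apply/mnm_lepP => j.
by rewrite mulmnE mnm1E; case: eqP => [<-|]; rewrite ?mul0n.
Qed.

Lemma size_bits_of_mnm v : size (bits_of_mnm v) = n.
Proof. by rewrite size_map size_enum_ord. Qed.

Lemma nth_bits_of_mnm v (i : 'I_n) : nth false (bits_of_mnm v) i = (v i != 0%N).
Proof. by rewrite (nth_map i) ?size_enum_ord // nth_ord_enum. Qed.

Lemma bits_of_mnmK v : square_free_mnm v -> mnm_of_bits (bits_of_mnm v) = v.
Proof.
move/square_free_mnmP => v1; apply/mnmP => i; rewrite mnmE nth_bits_of_mnm.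
by case: (v i) (v1 i) => [|[]].
Qed.

Lemma mnm_of_bitsK m : size m = n -> bits_of_mnm (mnm_of_bits m) = m.
Proof.
move=> sm; apply: (eq_from_nth (x0 := false)); rewrite size_bits_of_mnm // => i lti.
by rewrite (nth_bits_of_mnm _ (Ordinal lti)) mnmE /=; case: nth.
Qed.

Lemma square_free_mnm_of_bits m : square_free_mnm (mnm_of_bits m).
Proof. by apply/square_free_mnmP => i; rewrite mnmE leq_b1. Qed.

Lemma mdeg_mnm_of_bits m : size m = n -> mdeg (mnm_of_bits m) = count id m.
Proof.
move=> sm; rewrite mdegE -sumn_count -[in RHS](mkseq_nth false m) sm.
rewrite sumnE !big_map -val_enum_ord big_map big_enum.
by apply: eq_bigr => i _; rewrite mnmE.
Qed.

Lemma mnm_setP X v :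
  reflect (exists2 m, m \in X & v = mnm_of_bits m) (v \in mnm_set X).
Proof. exact: imfsetP. Qed.

Lemma card_mnm_set X :
  {subset X <= cube n} -> uniq X -> #|` mnm_set X| = size X.
Proof.
move=> sX uX; rewrite card_in_imfset /= ?undup_id // => x y.
move=> /sX; rewrite mem_cube => /eqP sx /sX; rewrite mem_cube => /eqP sy.
by move/(congr1 bits_of_mnm); rewrite !mnm_of_bitsK.
Qed.

Lemma perm_seq_of_perm s : perm_eq (seq_of_perm s) (iota 0 n).
Proof.
rewrite -val_enum_ord /seq_of_perm (map_comp val); apply: perm_map.
apply: uniq_perm; rewrite ?enum_uniq ?(map_inj_uniq perm_inj) ?enum_uniq //.
move=> i; rewrite mem_enum; apply/mapP; exists (s i); rewrite ?mem_enum //.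
by rewrite permK.
Qed.

Lemma seq_of_permP (p : seq nat) :
  perm_eq p (iota 0 n) -> exists s, seq_of_perm s = p.
Proof.
move=> pP; have sp : size p = n by rewrite (perm_size pP) size_iota.
have ltp (i : 'I_n) : (nth 0%N p i < n)%N.
  have: nth 0%N p i \in iota 0 n by rewrite -(perm_mem pP) mem_nth // sp.
  by rewrite mem_iota.
have injp : injective (fun i => Ordinal (ltp i)).
  move=> i j /(congr1 val) /= /eqP; rewrite nth_uniq ?sp // => [/eqP/val_inj//|].
  by rewrite (perm_uniq pP) iota_uniq.
exists (perm injp)^-1%g; apply: (eq_from_nth (x0 := 0%N)).
  by rewrite size_map size_enum_ord.
rewrite size_map size_enum_ord => i lti.
by rewrite (nth_map (Ordinal lti)) ?size_enum_ord // invgK permE /= nth_enum_ord.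
Qed.

Lemma nth_seq_of_perm s (i : 'I_n) : nth 0%N (seq_of_perm s) i = (s^-1)%g i.
Proof. by rewrite (nth_map i) ?size_enum_ord // nth_ord_enum. Qed.

Lemma mnm_act_of_bits s m :
  mnm_act s (mnm_of_bits m) = mnm_of_bits (relabel (seq_of_perm s) m).
Proof.
apply/mnmP => i; rewrite !mnmE (nth_relabel _ (perm_seq_of_perm s)) //.
by rewrite nth_seq_of_perm.
Qed.

Lemma mnm_actE s (v : 'X_{1..n}) i : mnm_act s v i = v ((s^-1)%g i).
Proof. exact: mnmE. Qed.

Lemma mnm_act1 (v : 'X_{1..n}) : mnm_act 1 v = v.
Proof. by apply/mnmP => i; rewrite mnm_actE invg1 perm1. Qed.

Lemma mnm_actM s u (v : 'X_{1..n}) : mnm_act (s * u) v = mnm_act u (mnm_act s v).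
Proof. by apply/mnmP => i; rewrite !mnm_actE invMg permM. Qed.

Lemma mnm_actK s : cancel (mnm_act s) (mnm_act s^-1).
Proof. by move=> v; rewrite -mnm_actM mulgV mnm_act1. Qed.

Lemma mnm_actKV s : cancel (mnm_act s^-1) (mnm_act s).
Proof. by move=> v; rewrite -mnm_actM mulVg mnm_act1. Qed.

Lemma mnm_actD s (v w : 'X_{1..n}) :
  mnm_act s (v + w)%MM = (mnm_act s v + mnm_act s w)%MM.
Proof. by apply/mnmP => i; rewrite !(mnm_actE, mnmDE). Qed.

Lemma mdeg_mnm_act s (v : 'X_{1..n}) : mdeg (mnm_act s v) = mdeg v.
Proof.
rewrite !mdegE (reindex_perm (s^-1)%g) [RHS](reindex_perm (s^-1)%g) /=.
rewrite [RHS](reindex_perm (s^-1)%g) /=.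
by apply: eq_bigr => i _; rewrite mnm_actE.
Qed.

Lemma mnm_act_square_free s (v : 'X_{1..n}) :
  square_free_mnm v -> square_free_mnm (mnm_act s v).
Proof. by rewrite !square_free_mnmP => v1 i; rewrite mnm_actE. Qed.

Lemma isomorphic_refl F : isomorphic F F.
Proof.
exists 1%g; rewrite -[LHS]imfset_id; apply: eq_imfset => // v.
by rewrite mnm_act1.
Qed.

Lemma isomorphic_trans F1 F2 F3 :
  isomorphic F1 F2 -> isomorphic F2 F3 -> isomorphic F1 F3.
Proof.
move=> [s ->] [u ->]; exists (s * u)%g.
rewrite -imfset_comp; apply: eq_imfset => // v /=.
by rewrite mnm_actM.
Qed.

Lemma isomorphic_sym F1 F2 : isomorphic F1 F2 -> isomorphic F2 F1.
Proof.
move=> [s ->]; exists s^-1%g; rewrite -imfset_comp -[LHS]imfset_id.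
by apply: eq_imfset => // v /=; rewrite mnm_actK.
Qed.

End Multinomials.

(** * Cremona sets up to isomorphism *)

Lemma fset_codom (T : choiceType) (n : nat) (F : {fset T}) :
  #|` F| = n -> exists t : 'I_n -> T, F =i codom t.
Proof.
move=> <-; exists (fun i => tnth (in_tuple (enum_fset F)) i) => v.
by apply/(tnthP (in_tuple (enum_fset F)) v)/codomP => -[i ->]; exists i.
Qed.

Lemma monomial_span_act k n (t : 'I_k -> 'X_{1..n}) s v :
  monomial_span t v -> monomial_span (fun i => mnm_act s (t i)) (mnm_act s v).
Proof.
move=> [c ->]; exists c; apply/mnmP => j.
rewrite mnm_actE !mnm_sumE; apply: eq_bigr => i _.
by rewrite !mulmnE mnm_actE.
Qed.

Lemma spans_degree_act k n (t : 'I_k -> 'X_{1..n}) s d :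
  spans_degree t d -> spans_degree (fun i => mnm_act s (t i)) d.
Proof.
move=> td m md; have [|a ta tma] := td (mnm_act s^-1 m).
  by rewrite mdeg_mnm_act.
exists (mnm_act s a); first exact: monomial_span_act.
by rewrite -[m](mnm_actKV s) -mnm_actD; apply: monomial_span_act.
Qed.

(** The equality of fraction fields is transported through the criterion on exponents, where the
    permutation acts directly and keeps degrees. *)
Lemma cremona_set_isomorphic (K : fieldType) n d (F F' : {fset 'X_{1..n}}) :
  isomorphic F F' -> cremona_set K d F -> cremona_set K d F'.
Proof.
move=> [s ->] [cF dF rF fF].
have dF' m : m \in [fset mnm_act s m | m in F]%fset -> mdeg m = d.
  by move=> /imfsetP[v Fv ->]; rewrite mdeg_mnm_act dF.
split=> //.
- rewrite -[RHS]cF; apply: card_imfset; exact: can_inj (mnm_actK s).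
- have lep_act j v : (U_(j) <= mnm_act s v)%MM = (U_((s^-1)%g j) <= v)%MM.
    by rewrite !lep1mP mnm_actE.
  move=> j; have [[v Fv vj] [w Fw wj]] := rF ((s^-1)%g j); split.
    by exists (mnm_act s v); rewrite ?lep_act // in_imfset.
  by exists (mnm_act s w); rewrite ?lep_act // in_imfset.
- have [t Ft] := fset_codom cF.
  have sFt : [fset mnm_act s m | m in F]%fset =i codom (fun i => mnm_act s (t i)).
    move=> v; apply/imfsetP/codomP => [[w /=]|[i ->]].
      by rewrite Ft => /codomP[i ->] ->; exists i.
    by exists (t i) => //=; rewrite Ft codom_f.
  by apply/(fraction_field_eqP K sFt dF')/spans_degree_act/(fraction_field_eqP K Ft dF).
Qed.

(** * Boolean tests for the Cremona conditions *)

Definition restricted n (X : seq bitseq) : bool :=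
  all (fun j => has (fun m => nth false m j) X && has (fun m => ~~ nth false m j) X)
    (iota 0 n).

Definition unimodular n (X : seq bitseq) : bool :=
  (`|bit_det n [seq true :: behead m | m <- X]|%N == 1)%N.

Definition cremona_bits n (X : seq bitseq) : bool :=
  [&& size X == n, restricted n X & unimodular n X].

Lemma restrictedP n (X : seq bitseq) :
  canonical_restrictions (mnm_set n X) <-> restricted n X.
Proof.
have lep_bit j m : (U_(j) <= mnm_of_bits n m)%MM = nth false m j.
  by rewrite lep1mP mnmE; case: nth.
split=> [rX|/allP rX j].
  apply/allP => j; rewrite mem_iota => /= ltj.
  have [[_ /mnm_setP[m Xm ->] mj] [_ /mnm_setP[m' Xm' ->] m'j]] := rX (Ordinal ltj).
  rewrite !lep_bit in mj m'j.
  by apply/andP; split; apply/hasP; [exists m | exists m'].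
have /rX/andP[/hasP[m Xm mj] /hasP[m' Xm' m'j]] : val j \in iota 0 n.
  by rewrite mem_iota /=.
split.
  by exists (mnm_of_bits n m); rewrite ?lep_bit //; apply/mnm_setP; exists m.
by exists (mnm_of_bits n m'); rewrite ?lep_bit //; apply/mnm_setP; exists m'.
Qed.

Lemma unimodularP n (X : seq bitseq) : size X = n.+1 ->
  unimodular n.+1 X =
  (reduced_log_matrix (fun i : 'I_n.+1 => mnm_of_bits n.+1 (nth [::] X i)) \in unitmx).
Proof.
have absz_unit (x : int) : (`|x|%N == 1%N) = (x \is a GRing.unit).
  by case: x => [[|[|k]]|[|k]].
move=> sX; rewrite /unimodular bit_detE ?size_map // absz_unit unitmxE.
congr (\det _ \is a GRing.unit).
apply/matrixP => i j; rewrite !mxE (nth_map [::]) ?sX // mnmE.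
by case: (unliftP ord0 j) => [j' ->|->] //=; rewrite nth_behead.
Qed.

Lemma cremona_bitsP (K : fieldType) n d (X : seq bitseq) :
  (0 < d)%N -> {subset X <= slice n.+1 d} -> uniq X ->
  cremona_set K d (mnm_set n.+1 X) <-> cremona_bits n.+1 X.
Proof.
move=> d0 sX uX.
have dX m : m \in mnm_set n.+1 X -> mdeg m = d.
  move=> /mnm_setP[w /sX + ->]; rewrite mem_slice => /andP[/eqP wd /eqP sw].
  by rewrite mdeg_mnm_of_bits.
have cX : #|` mnm_set n.+1 X| = size X.
  by apply: card_mnm_set => // m /sX/slice_cube.
have [sXn|sXn] := eqVneq (size X) n.+1; last first.
  rewrite /cremona_bits (negPf sXn); split=> // -[cXn _ _ _]; move: sXn.
  by rewrite -cX cXn eqxx.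
pose t (i : 'I_n.+1) := mnm_of_bits n.+1 (nth [::] X i).
have Xt : mnm_set n.+1 X =i codom t.
  move=> v; apply/mnm_setP/codomP => [[m Xm ->]|[i ->]].
    have ltm : (index m X < n.+1)%N by rewrite -sXn index_mem.
    by exists (Ordinal ltm); rewrite /t /= nth_index.
  by exists (nth [::] X i) => //; rewrite mem_nth // sXn.
have td i : mdeg (t i) = d by apply: dX; rewrite Xt codom_f.
have fP := fraction_field_eqP K Xt dX.
have uP := spans_degreeP d0 td.
rewrite /cremona_bits sXn eqxx (unimodularP sXn) /=; split.
  by move=> [_ _ /restrictedP-> /fP/uP].
move=> /andP[/restrictedP rX /uP/fP ?]; split=> //.
by rewrite cX.
Qed.

(** * Enumeration up to isomorphism *)

(** Entries are binary numbers, which keeps the evaluation of the keys cheap. *)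
Definition table (p : seq nat) (f : nat -> nat -> N) : seq (seq N) :=
  [seq [seq f i j | j <- p] | i <- p].

Definition dot (u v : seq N) : N := foldr N.add N0 [seq N.mul x.1 x.2 | x <- zip u v].

(** The codegree matrix A is symmetric, so its Gram matrix is A^2. *)
Definition gram (A : seq (seq N)) : seq (seq N) := [seq [seq dot r s | s <- A] | r <- A].

Definition codegree (X : seq bitseq) (i j : nat) : N :=
  bin_of_nat (count (fun m => nth false m i && nth false m j) X).

(** As A^2 is symmetric too, the squared norms of its rows are the diagonal entries of A^4. *)
Definition keys n (X : seq bitseq) : seq N :=
  [seq dot r r | r <- gram (table (iota 0 n) (codegree X))].

HB.instance Definition _ :=
  Monoid.isComLaw.Build N N0 N.add N.add_assoc N.add_comm N.add_0_l.

Lemma dot_map (p : seq nat) (f g : nat -> N) :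
  dot [seq f k | k <- p] [seq g k | k <- p] = \big[N.add/N0]_(k <- p) N.mul (f k) (g k).
Proof. by elim: p => [|k p IHp]; rewrite ?big_nil // big_cons -IHp. Qed.

Lemma gram_table (p : seq nat) (f : nat -> nat -> N) :
  gram (table p f) = table p (fun i j => \big[N.add/N0]_(k <- p) N.mul (f i k) (f j k)).
Proof.
rewrite /gram /table -map_comp; apply: eq_map => i /=.
by rewrite -map_comp; apply: eq_map => j /=; apply: dot_map.
Qed.

(** Reordering [p] permutes rows and columns simultaneously. Each diagonal entry is a sum over [p],
    hence keeps its value and only changes its place. *)
Lemma gram_diag_perm (p q : seq nat) (f : nat -> nat -> N) :
  perm_eq p q ->
  perm_eq [seq dot r r | r <- gram (table p f)] [seq dot r r | r <- gram (table q f)].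
Proof.
move=> pq; rewrite !gram_table -!map_comp; apply: (perm_trans (perm_map _ pq)).
set L := (L in perm_eq L _); set R := (R in perm_eq _ R).
suff -> : L = R by []; apply: eq_map => i /=.
rewrite !dot_map (perm_big _ pq) /=; apply: eq_bigr => k _.
by rewrite !(perm_big _ pq).
Qed.

(** Codegrees are counts, blind to the order of the monomials, while relabelling the variables only
    moves the indices along [p]. *)
Lemma table_relabel n p (X Y : seq bitseq) :
  perm_eq p (iota 0 n) -> perm_eq Y [seq relabel p m | m <- X] ->
  table (iota 0 n) (codegree Y) = table p (codegree X).
Proof.
move=> pP YX; rewrite -[p in RHS](mkseq_nth 0%N) (perm_size pP) size_iota.
rewrite /table /mkseq -map_comp; apply/eq_in_map => i /=; rewrite mem_iota => /= lti.
rewrite -map_comp; apply/eq_in_map => j /=; rewrite mem_iota => /= ltj.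
rewrite /codegree (seq.permP YX) count_map; congr bin_of_nat.
by apply: eq_count => m /=; rewrite !(nth_relabel _ pP).
Qed.

(** Used contrapositively: different multisets of keys certify that two sets are not isomorphic. *)
Lemma keys_isomorphic n (X Y : seq bitseq) :
  {subset X <= cube n} -> {subset Y <= cube n} -> uniq X -> uniq Y ->
  isomorphic (mnm_set n X) (mnm_set n Y) -> perm_eq (keys n Y) (keys n X).
Proof.
move=> sX sY uX uY [s YX].
have pP := perm_seq_of_perm s; set p := seq_of_perm s in pP.
have relabel_size m : size (relabel p m) = n.
  by rewrite size_map (perm_size pP) size_iota.
have size_cube m : m \in cube n -> size m = n by rewrite mem_cube => /eqP.
have bitsI m m' : size m = n -> size m' = n -> mnm_of_bits n m = mnm_of_bits n m' -> m = m'.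
  by move=> sm sm' /(congr1 (@bits_of_mnm n)); rewrite !mnm_of_bitsK.
rewrite /keys (table_relabel (p := p) (X := X)) //; first exact: gram_diag_perm.
apply: uniq_perm => // [|y].
  rewrite map_inj_in_uniq // => x x' Xx Xx' /(congr1 (mnm_of_bits n)).
  rewrite -!mnm_act_of_bits => /(can_inj (mnm_actK s)).
  by apply: bitsI; apply: size_cube; apply: sX.
apply/idP/mapP => [Yy|[m Xm ->]].
  have: mnm_of_bits n y \in mnm_set n Y by apply/mnm_setP; exists y.
  rewrite YX => /imfsetP[_ /mnm_setP[m Xm ->]]; rewrite mnm_act_of_bits => ym.
  by exists m => //; apply: bitsI ym; rewrite ?relabel_size ?size_cube ?sY.
have: mnm_act s (mnm_of_bits n m) \in mnm_set n Y.
  by rewrite YX in_imfset //=; apply/mnm_setP; exists m.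
rewrite mnm_act_of_bits => /mnm_setP[w Yw mw].
by rewrite (bitsI _ _ _ _ mw) ?relabel_size ?size_cube ?sY.
Qed.

(* Isomorphic sets may have distinct normal forms, when the sort meets equal keys. *)
Definition normalize n d (X : seq bitseq) : seq bitseq :=
  let ks := keys n X in
  let p := sort (fun i j => N.leb (nth N0 ks i) (nth N0 ks j)) (iota 0 n) in
  let Y := [seq relabel p m | m <- X] in
  [seq m <- slice n d | m \in Y].

Definition extensions n d (X : seq bitseq) : seq (seq bitseq) :=
  [seq normalize n d (m :: X) | m <- slice n d & m \notin X].

(** All square-free sets are kept at every stage, and the Cremona tests come after the last one.
    [undup] merges equal lists only, so an isomorphism class may appear several times. *)
Fixpoint level n d k : seq (seq bitseq) :=
  if k is k'.+1 then undup (flatten [seq extensions n d X | X <- level n d k'])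
  else [:: [::]].

(** Sorting yields some permutation of the variables, whatever the keys, so the way ties are broken
    cannot lose a class. *)
Lemma normalize_isomorphic n d X :
  {subset X <= slice n d} -> isomorphic (mnm_set n X) (mnm_set n (normalize n d X)).
Proof.
move=> sX; rewrite /normalize; set p := sort _ _.
have pP : perm_eq p (iota 0 n) by rewrite perm_sort.
have [s sp] := seq_of_permP pP; exists s; apply/fsetP => v.
apply/mnm_setP/imfsetP => [[m]|[_ /mnm_setP[m Xm ->] ->]].
  rewrite mem_filter => /andP[/mapP[w Xw ->] _ ->].
  exists (mnm_of_bits n w); first by apply/mnm_setP; exists w.
  by rewrite mnm_act_of_bits sp.
exists (relabel p m); last by rewrite mnm_act_of_bits sp.
by rewrite mem_filter map_f //= relabel_slice ?sX.
Qed.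

Lemma level_slice n d k X : X \in level n d k -> {subset X <= slice n d} /\ uniq X.
Proof.
case: k => [|k] /=; first by rewrite inE => /eqP->.
rewrite mem_undup => /flatten_mapP[Y _ /mapP[m _ ->]]; split.
  exact: mem_subseq (filter_subseq _ _).
by rewrite !filter_uniq ?cube_uniq.
Qed.

(** Induction by removing one monomial [v]: an isomorphism [s] from the rest of [F] to an enumerated
    [Y] sends [v] to a monomial by which [Y] gets extended. *)
Lemma level_complete n d k (F : {fset 'X_{1..n}}) :
  #|` F| = k -> square_free F -> (forall m, m \in F -> mdeg m = d) ->
  exists2 X, X \in level n d k & isomorphic F (mnm_set n X).
Proof.
elim: k F => [|k IHk] F cF sfF dF.
  exists [::]; first by rewrite inE.
  rewrite (cardfs0_eq cF) (_ : mnm_set n [::] = fset0); first exact: isomorphic_refl.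
  by apply/fsetP => v; apply/mnm_setP; rewrite inE => -[].
have [v Fv] : exists v, v \in F by apply/fset0Pn; rewrite -cardfs_gt0 cF.
have cF' : #|` (F `\ v)%fset| = k by move: cF; rewrite (cardfsD1 v) Fv => -[].
have [||Y lY [s YE]] := IHk _ cF'.
- by move=> m; rewrite in_fsetD1 => /andP[_ /sfF].
- by move=> m; rewrite in_fsetD1 => /andP[_ /dF].
have [sY uY] := level_slice lY.
have sfv := mnm_act_square_free s (sfF v Fv).
pose m := bits_of_mnm (mnm_act s v).
have mE : mnm_of_bits n m = mnm_act s v by rewrite bits_of_mnmK.
have sm : m \in slice n d.
  by rewrite mem_slice -(mdeg_mnm_of_bits (n := n)) size_bits_of_mnm // mE mdeg_mnm_act dF ?eqxx.
(* The action is injective and [v] was removed from [F], so its image is new. *)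
have nYm : m \notin Y.
  apply/negP => Ym; have: mnm_act s v \in mnm_set n Y by apply/mnm_setP; exists m.
  rewrite YE => /imfsetP[w /= + /(can_inj (mnm_actK s)) vw].
  by rewrite -vw in_fsetD1 eqxx.
exists (normalize n d (m :: Y)).
  rewrite mem_undup; apply/flatten_mapP; exists Y => //.
  by apply: map_f; rewrite mem_filter nYm.
apply: isomorphic_trans (normalize_isomorphic _) => [|w]; last first.
  by rewrite inE => /predU1P[->|/sY].
(* The same [s] carries all of [F] onto [m :: Y]. *)
exists s; rewrite -[in RHS](fsetD1K Fv) imfsetU1 -YE -mE.
apply/fsetP => w; rewrite in_fset1U; apply/mnm_setP/predU1P.
  by move=> [b /predU1P[->|Yb] ->]; [left | right; apply/mnm_setP; exists b].
move=> [->|/mnm_setP[b Yb ->]]; first by exists m; rewrite ?mem_head.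
by exists b; rewrite // inE Yb orbT.
Qed.

(** * Counting the classes *)

Definition representatives n (ds : seq nat) : seq (seq bitseq) :=
  flatten [seq [seq X <- level n d n | cremona_bits n X] | d <- ds].

Lemma representativesP n ds X :
  reflect (exists d, [/\ d \in ds, X \in level n d n & cremona_bits n X])
          (X \in representatives n ds).
Proof.
apply: (iffP flatten_mapP) => [[d dds]|[d [dds lX cX]]].
  by rewrite mem_filter => /andP[cX lX]; exists d.
by exists d; rewrite // mem_filter cX.
Qed.

(** The enumeration is exhaustive by [level_complete] and irredundant as soon as the keys differ
    pairwise, which reduces the count to a boolean check on lists. *)
Lemma number_of_square_free_cremona_classes (K : fieldType) n (ds : seq nat) :
  0%N \notin ds ->
  pairwise (fun X Y => ~~ perm_eq (keys n.+1 X) (keys n.+1 Y)) (representatives n.+1 ds) ->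
  number_of_classes
    (fun F : {fset 'X_{1..n.+1}} =>
       square_free F /\ exists2 d : nat, d \in ds & cremona_set K d F)
    (@isomorphic n.+1) (size (representatives n.+1 ds)).
Proof.
move=> ds0; set reps := representatives _ _ => keys_reps.
have ds_gt0 d : d \in ds -> (0 < d)%N by case: d => // /(negP ds0).
have reps_cube X : X \in reps -> {subset X <= cube n.+1} /\ uniq X.
  move=> /representativesP[d [_ /level_slice[sX uX] _]].
  by split=> // m /sX/slice_cube.
pose r (i : 'I_(size reps)) := nth [::] reps i.
have r_rep i : r i \in reps by rewrite mem_nth.
have keys_neq (i j : 'I_(size reps)) : (i < j)%N -> ~~ perm_eq (keys n.+1 (r i)) (keys n.+1 (r j)).
  by move=> ij; apply: (pairwiseP [::] keys_reps); rewrite ?inE.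
exists (fun i => mnm_set n.+1 (r i)); split=> [i|i j rij|F [sfF [d dds cF]]].
- split; first by move=> _ /mnm_setP[m _ ->]; apply: square_free_mnm_of_bits.
  have /representativesP[d [dds /level_slice[sX uX] cX]] := r_rep i.
  by exists d => //; apply/cremona_bitsP => //; apply: ds_gt0.
- have [[sXi uXi] [sXj uXj]] := (reps_cube _ (r_rep i), reps_cube _ (r_rep j)).
  have keys_ij := keys_isomorphic sXi sXj uXi uXj rij.
  (* The pairwise check covers [i < j]; the other order follows by symmetry of [perm_eq]. *)
  apply: val_inj; case: (ltngtP i j) => //= [/keys_neq|/keys_neq].
    by rewrite perm_sym keys_ij.
  by rewrite keys_ij.
have [cardF dF _ _] := cF.
have [X lX FX] := level_complete cardF sfF dF.
have [sX uX] := level_slice lX.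
have repX : X \in reps.
  apply/representativesP; exists d; split=> //.
  (* [X] passes the boolean test because the Cremona property of [F] moves along the isomorphism. *)
  apply/(cremona_bitsP K (ds_gt0 d dds) sX uX).
  exact: cremona_set_isomorphic FX cF.
have ltX : (index X reps < size reps)%N by rewrite index_mem.
exists (Ordinal ltX); rewrite /r /= nth_index //.
exact: isomorphic_sym.
Qed.

(** The whole enumeration is evaluated here. It does not involve the field, so one computation
    serves every [K]. *)
Lemma representatives6 :
  (size (representatives 6 (iota 1 5)) == 58%N) &&
  pairwise (fun X Y => ~~ perm_eq (keys 6 X) (keys 6 Y)) (representatives 6 (iota 1 5)).
Proof. by vm_compute. Qed.

Theorem theorem4p1 (K : fieldType) :
  number_of_classes
    (fun F : {fset 'X_{1..6}} =>
       square_free F /\ exists2 d : nat, (1 <= d <= 5)%N & cremona_set K d F)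
    (@isomorphic 6) 58.
Proof.
have /andP[/eqP size58 keys58] := representatives6.
have := @number_of_square_free_cremona_classes K 5 (iota 1 5) isT keys58.
rewrite size58 => {size58 keys58} -[r [rP r_inj r_sur]].
exists r; split=> // [i|F [sfF [d d15 cF]]].
  by have [sfr [d]] := rP i; rewrite mem_iota => d15 cr; split; last exists d.
by apply: r_sur; split; last exists d; rewrite ?mem_iota.
Qed.
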